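(* Let $n\in\mathbb{N}$ and $k,s\in\mathbb{Z}_{\geq 0}$ with $n>k$, and let $\zeta_n$ be a fixed primitive $n$-th root of unity. Then the following two statements are equivalent: (i) for any $d_0,d_1,\ldots,d_s\in\mathbb{Z}_{\geq 0}$ with $\sum_{j=0}^{s}d_j=k-2s$, it holds $$C_n^1(d_0,d_1,\ldots,d_s)=\frac{(-1)^s}{n}\binom{n+s}{k+1}(1-\zeta_n)^k;$$ (ii) for any $d_0,\ldots,d_s,d_0',\ldots,d_s'\in\mathbb{Z}_{\geq 0}$ with $\sum_{j=0}^{s}d_j=\sum_{j=0}^{s}d_j'=k-2s$, it holds $$C_n^1(d_0,d_1,\ldots,d_s)=C_n^1(d_0',d_1',\ldots,d_s').$$
   Context: $\mathbb{N}$ is the set of positive integers. For $n\in\mathbb{N}$, a complex number $q$ with $q^m\neq 1$ for all $m\in\mathbb{N}$ with $m<n$, and a multi-index $(k_1,\ldots,k_d)\in\mathbb{N}^d$, the finite multiple harmonic $q$-series is $$z_n(k_1,\ldots,k_d;q)=\sum_{n>m_1>\cdots>m_d>0}\frac{q^{(k_1-1)m_1+\cdots+(k_d-1)m_d}}{[m_1]^{k_1}\cdots[m_d]^{k_d}},\qquad [m]=\frac{1-q^m}{1-q},$$ where $m_1,\dots,m_d$ are integers. An empty sum is $0$, and for the empty multi-index ($d=0$) one sets $z_n(\emptyset;q)=1$. The notation $\{a\}^{m}$ means $a$ repeated $m$ times. For $r\in\mathbb{N}$ and $s,d_0,\ldots,d_s\in\mathbb{Z}_{\geq 0}$ the cyclic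 sum is $$C_n^r(d_0,d_1,\ldots,d_s)=\sum_{j=0}^{s}z_n\left(\{r\}^{d_j},r+1,\{r\}^{d_{j+1}},r+1,\ldots,r+1,\{r\}^{d_{j+s}};\zeta_n\right),$$ where indices of $d$ are read modulo $s+1$ (so $d_j=d_i$ if $j\equiv i$ modulo $s+1$), and in each term the entry $r+1$ occurs exactly $s$ times. Here $r=1$. Binomial coefficients $\binom{a}{b}$ with integers $a\ge 0$ are $0$ if $b<0$ or $b>a$; $0^0=1$. *)

(* Defs.v *)
From mathcomp Require Import all_boot all_order all_algebra.
From mathcomp Require Import reals complex.

Set Implicit Arguments.
Unset Strict Implicit.
Unset Printing Implicit Defensive.

Import GRing.Theory Num.Theory.
Local Open Scope ring_scope.

Definition qint (F : fieldType) (q : F) (m : nat) : F := (1 - q ^+ m) / (1 - q).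

(* The summation range is n > m_1 > ... > m_d > 0, with d = size k and the
   bound n > m_j carried by 'I_n; positions are numbered from 0, so m_(j+1) is
   tnth m j. The predecessor (k_j).-1 is k_j - 1 only for positive entries,
   which is all a multi-index is allowed to have. *)
Definition zq (F : fieldType) (n : nat) (k : seq nat) (q : F) : F :=
  \sum_(m : (size k).-tuple 'I_n |
          sorted (fun a b : 'I_n => (b < a)%N) m &&
          all (fun a : 'I_n => (0 < a)%N) m)
    q ^+ (\sum_(j < size k) (nth 0 k j).-1 * tnth m j)%N
      / \prod_(j < size k) qint q (tnth m j) ^+ nth 0%N k j.

(* {r}^(d_j), r+1, {r}^(d_(j+1)), r+1, ..., r+1, {r}^(d_(j+s)); here inZp
   reduces the index of d modulo s+1. *)
Definition cyc_index (r s : nat) (d : 'I_s.+1 -> nat) (j : 'I_s.+1) : seq nat :=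
  nseq (d j) r
    ++ flatten [seq r.+1 :: nseq (d (inZp (j + i))) r | i <- iota 1 s].

(* C_n^r(d_0, ..., d_s), with zeta in the role of zeta_n. *)
Definition cyc_sum (F : fieldType) (n r s : nat) (d : 'I_s.+1 -> nat)
    (zeta : F) : F :=
  \sum_(j < s.+1) zq n (cyc_index r d j) zeta.

(* Main.v *)
(* If C = C_n^1(d_0, ..., d_s) does not depend on d, it is the average of its
   values over all d with a := sum d = k - 2s. This average is governed by the
   sum of z_n over all multi-indices with a entries 1 and s entries 2, i.e. by
   the coefficient of u^a v^s in prod_(0 < m < n) (1 + u/[m] + v q^m/[m]^2).
   After rescaling u, v and clearing denominators, the product becomes
     prod_(0 < m < n) ((1 - q^m)^2 + (1 - q^m) u + q^m v),
   whose factors are the values at q^m of X^2 - c X + p with c = 2 + u - v and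
   p = 1 + u; the missing factor m = 0 is v. For the companion matrix M of
   that polynomial, taking determinants in prod_m (M - q^m) = M^n - 1 shows
   that the full product is 1 + p^n - tr(M^n), and the coefficients of tr(M^n)
   follow from the linear recurrence satisfied by the powers of M. *)

Require Import Defs.
From mathcomp Require Import all_boot all_order all_algebra.
From mathcomp Require Import reals complex ring zify.

Set Implicit Arguments.
Unset Strict Implicit.
Unset Printing Implicit Defensive.

Import GRing.Theory Num.Theory.
Local Open Scope ring_scope.

(** * Powers of a 2 by 2 companion matrix and the product over roots of unity *)

Lemma mul_mx22E (T : comNzRingType) (A B : 'M[T]_2) i j :
  (A * B) i j = A i 0 * B 0 j + A i 1 * B 1 j.
Proof.
rewrite mxE !big_ord_recl big_ord0 addr0.
by congr (_ + A i _ * B _ j); apply: val_inj.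
Qed.

Lemma det_mx22 (T : comNzRingType) (A : 'M[T]_2) :
  \det A = A 0 0 * A 1 1 - A 0 1 * A 1 0.
Proof.
rewrite (expand_det_row _ 0) !big_ord_recl big_ord0 addr0 /cofactor !det_mx11.
rewrite !mxE /= expr0 expr1 mul1r mulN1r mulrN.
by congr (_ * A _ _ - A _ _ * A _ _); apply: val_inj.
Qed.

Lemma mxtrace22 (T : comNzRingType) (A : 'M[T]_2) : \tr A = A 0 0 + A 1 1.
Proof.
rewrite /mxtrace !big_ord_recl big_ord0 addr0.
by congr (_ + A _ _); apply: val_inj.
Qed.

(** Companion matrix of X^2 - c X + p. The (1, 0) entries of its powers form the Lucas sequence 0,
    1, c, ... with parameters c and p. *)
Definition quad_mx (T : comNzRingType) (c p : T) : 'M[T]_2 :=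
  \matrix_(i, j) nth 0 (nth [::] [:: [:: c; - p]; [:: 1; 0]] i) j.

Section QuadMx.
Variables (T : comNzRingType) (c p : T).
Let M := quad_mx c p.

Lemma quad_mx_exp10 n : (M ^+ n.+1) 1 0 = (M ^+ n) 0 0.
Proof. by rewrite exprS mul_mx22E !mxE /= mul1r mul0r addr0. Qed.

Lemma quad_mx_exp10S n :
  (M ^+ n.+2) 1 0 = c * (M ^+ n.+1) 1 0 - p * (M ^+ n) 1 0.
Proof. by rewrite !quad_mx_exp10 exprS mul_mx22E !mxE /= mulNr. Qed.

Lemma quad_mx_tr n :
  \tr (M ^+ n.+1) = (M ^+ n.+2) 1 0 - p * (M ^+ n) 1 0.
Proof.
rewrite mxtrace22 -quad_mx_exp10; congr (_ + _).
by rewrite exprSr mul_mx22E !mxE /= mulr0 addr0 mulrN mulrC.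
Qed.

Lemma prod_quad (F : fieldType) (f : {rmorphism F -> T}) n q :
  (0 < n)%N -> n.-primitive_root q ->
  \prod_(0 <= m < n) (p - c * f (q ^+ m) + f (q ^+ m) ^+ 2)
  = 1 + p ^+ n - \tr (M ^+ n).
Proof.
case: n => // n _ /factor_Xn_sub_1 /(congr1 (map_poly f)).
rewrite rmorph_prod rmorphB /= rmorph1 map_polyXn => /(congr1 (horner_mx M)).
rewrite rmorph_prod rmorphB rmorph1 rmorphXn /= horner_mx_X.
move=> /(congr1 determinant).
have -> : \det (\prod_(0 <= m < n.+1) horner_mx M (map_poly f ('X - (q ^+ m)%:P)))
   = \prod_(0 <= m < n.+1) \det (horner_mx M (map_poly f ('X - (q ^+ m)%:P))).
  by apply: (big_morph (fun A : 'M_2 => \det A)); [exact: detM | rewrite det1].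
have dM : \det M = p by rewrite det_mx22 !mxE /=; ring.
have -> : \prod_(0 <= m < n.+1) \det (horner_mx M (map_poly f ('X - (q ^+ m)%:P)))
   = \prod_(0 <= m < n.+1) (p - c * f (q ^+ m) + f (q ^+ m) ^+ 2).
  apply: eq_bigr => m _.
  rewrite rmorphB /= map_polyX map_polyC /= rmorphB /= horner_mx_X horner_mx_C.
  rewrite det_mx22 !mxE /=; ring.
move=> ->.
have dMn k : \det (M ^+ k) = p ^+ k.
  elim: k => [|k IH]; first by rewrite expr0 det1.
  by rewrite !exprS detM dM IH.
(* For a 2 by 2 matrix A, det (A - 1) = 1 + det A - tr A; here A is the power of [M]. *)
rewrite -dMn !det_mx22 mxtrace22.
have E i j : (M ^+ n.+1 - 1) i j = (M ^+ n.+1) i j - (i == j)%:R by rewrite !mxE.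
rewrite !E /=; ring.
Qed.
End QuadMx.

(** * Coefficients of the Lucas sequence, of the trace and of the product in two variables *)

Section Genfun.
Variable (F : fieldType).
Local Notation T := {poly {poly F}}.
(** [u] is the inner and [v] the outer variable, so the coefficient of u^i v^t in [p] is p[_t]_i. *)
Let u : T := 'X%:P.
Let v : T := 'X.
Let w n : T := (quad_mx (2 + u - v) (1 + u) ^+ n) 1 0.

Lemma coef_wS n t i :
  (w n.+2)`_t`_i = 2 * (w n.+1)`_t`_i - (w n)`_t`_i
    + (if i is i'.+1 then (w n.+1)`_t`_i' - (w n)`_t`_i' else 0)
    - (if t is t'.+1 then (w n.+1)`_t'`_i else 0).
Proof.
rewrite /w quad_mx_exp10S -/(w _) -/(w n).
have -> : (2 + u - v) * w n.+1 - (1 + u) * w n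
  = w n.+1 *+ 2 - w n + u * (w n.+1 - w n) - v * w n.+1 by ring.
rewrite !(coefB, coefD, coefMn) /u /v coefCM !coefXM.
case: t => [|t]; case: i => [|i] /=; rewrite ?coefXM ?coef0 ?coefB /= mulr_natl //.
Qed.

(* Read off from sum_n w_n z^n = z / ((1 - z) (1 - (1 + u) z) + v z). *)
Lemma coef_w n t i :
  (w n)`_t`_i = (-1) ^+ t * ('C(i + t, t) * 'C(n + t, t + t + i.+1))%:R.
Proof.
elim/ltn_ind: n t i => -[|[|n]] IH t i.
- rewrite /w expr0 mxE /= !coef0 (bin_small (m := t + t + i.+1)) ?muln0 ?mulr0 //; lia.
- rewrite /w expr1 mxE /= coef1; case: t => [|t]; rewrite ?coef1 ?coef0.
    rewrite bin0 !add0n addn0 expr0 mul1n mul1r; case: i => [//|i].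
    by rewrite bin_small.
  rewrite [in RHS](bin_small (m := t.+1 + t.+1 + i.+1)) ?muln0 ?mulr0 //; lia.
rewrite coef_wS.
(* Pascal's rule applied twice mirrors the second-order recurrence in n. *)
have pascal m : 'C(n.+2 + t, m.+2) = ('C(n + t, m.+2) + 'C(n + t, m.+1).*2 + 'C(n + t, m))%N.
  by rewrite !addSn !binS; lia.
case: t i pascal => [|t] [|i] pascal; rewrite !IH // {IH}.
- rewrite !addn0 !bin1 !bin0 expr0; ring.
- rewrite !add0n !bin0 pascal (addSn n 0) !binS expr0 -mul2n; ring.
- have -> : (t.+1 + t.+1 + 1 = (t + t + 1).+2)%N by lia.
  have -> : (n.+1 + t = n + t.+1)%N by lia.
  rewrite !add0n !binn pascal addSn binS exprS -mul2n; ring.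
- have -> : (t.+1 + t.+1 + i.+2 = (t + t + i.+2).+2)%N by lia.
  have -> : (t.+1 + t.+1 + i.+1 = (t + t + i.+2).+1)%N by lia.
  have -> : (n.+1 + t = n + t.+1)%N by lia.
  have -> : 'C(i.+1 + t.+1, t.+1) = ('C(i + t.+1, t.+1) + 'C(i.+1 + t, t))%N.
    by rewrite addSn binS addnS addSn.
  rewrite pascal addSn !binS exprS -mul2n; ring.
Qed.

(** The bracket on the left is, up to sign, what Pascal's rule makes of the coefficient of u^i
    v^(t+1) in w_(N+2) - (1 + u) w_N. Absorption turns every product into a multiple of 'C(i + t,
    t). *)
Lemma bin_trace_identity N t i :
  (t.+1 * ('C(i + t.+1, t.+1) * 'C((N + t.+1).+1, (t + i).+1 + t.+1)
           + 'C(i + t, t) * 'C(N + t.+1, (t + i).+1 + t.+1))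
   = N.+1 * ('C(i + t, t) * 'C(N + t.+1, (t + i + t).+1)))%N.
Proof.
have -> : ((t + i).+1 + t.+1 = (t + i + t).+2)%N by lia.
have H1 := mul_bin_diag (i + t).+1 t.
have H2 := mul_bin_diag (N + t.+1).+1 (t + i + t).+1.
rewrite mulnDr mulnA (addnS i) -H1 binS; rewrite /= binS in H2.
move: 'C(_, _) 'C(_, _) 'C(_, _) H2 => e b a H2.
by nia.
Qed.

(** The factor [t.+1] clears the only denominator, so the formula holds in every characteristic. *)
Lemma coef_tr n t i :
  t.+1%:R * (\tr (quad_mx (2 + u - v) (1 + u) ^+ n.+1))`_t.+1`_i
  = (-1) ^+ t.+1 * (n.+1 * ('C(i + t, t) * 'C(n + t.+1, (t + i + t).+1)))%:R :> F.
Proof.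
rewrite -bin_trace_identity quad_mx_tr -/(w _) -/(w n) mulrDl mul1r opprD.
rewrite addrA /u !coefB coefCM coefXM.
have -> : ((t + i).+1 + t.+1 = (t + t + i).+2)%N by lia.
case: i => [|i]; rewrite !coef_w.
  rewrite !add0n !binn addn0 !mul1n addn1 !(addnS, addSn) !binS exprS /=; ring.
have -> : ('C(i.+1 + t.+1, t.+1) = 'C(i + t.+1, t.+1) + 'C(i.+1 + t, t))%N.
  by rewrite addSn binS addnS addSn.
have -> : (t.+1 + t.+1 + i.+2 = (t + t + i.+1).+3)%N by lia.
have -> : (t.+1 + t.+1 + i.+1 = (t + t + i.+1).+2)%N by lia.
rewrite (addSn n.+1) (addSn n) !binS /=; ring.
Qed.

Let cst (x : F) : T := x%:P%:P.

Definition unity_prod (q : F) n : T :=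
  \prod_(1 <= m < n)
    ((1 - cst (q ^+ m)) ^+ 2 + (1 - cst (q ^+ m)) * u + cst (q ^+ m) * v).

(** Splitting off the last factor gives a recurrence of the same shape as [zsumS], to be compared
    with it in [zsum_unity_prod]. *)
Lemma coef_unity_prodS q n s a : (0 < n)%N ->
  (unity_prod q n.+1)`_s`_a = (1 - q ^+ n) ^+ 2 * (unity_prod q n)`_s`_a
    + (if a is a'.+1 then (1 - q ^+ n) * (unity_prod q n)`_s`_a' else 0)
    + (if s is s'.+1 then q ^+ n * (unity_prod q n)`_s'`_a else 0).
Proof.
move=> n_gt0; rewrite {1}/unity_prod big_nat_recr //= -/(unity_prod q n).
have -> : 1 - cst (q ^+ n) = cst (1 - q ^+ n) by rewrite /cst !polyCB !polyC1.
have -> : cst (1 - q ^+ n) ^+ 2 = cst ((1 - q ^+ n) ^+ 2).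
  by rewrite /cst !rmorphXn.
rewrite mulrC !mulrDl /cst /u /v -!mulrA !(coefD, coefCM, coefXM).
by case: a s => [|a] [|s]; rewrite /= ?coef0 ?mulr0 ?coefCM ?expr2 -?mulrA.
Qed.

Lemma coef_unity_prod q n s a : (0 < n)%N -> n.-primitive_root q ->
  s.+1%:R * (unity_prod q n)`_s`_a
  = (-1) ^+ s * (n * ('C(a + s, s) * 'C(n + s, (a + 2 * s).+1)))%:R.
Proof.
case: n => // n _ q_prim.
have /= := @prod_quad T (2 + u - v) (1 + u) F (polyC \o polyC) n.+1 q isT q_prim.
have quadE x : 1 + u - (2 + u - v) * x + x ^+ 2
    = (1 - x) ^+ 2 + (1 - x) * u + x * v by ring.
under eq_bigr => m _ do rewrite quadE.
rewrite big_ltn //= expr0 polyC1 subrr mul0r expr0n /= !add0r mul1r.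
(* The factor at m = 0 being v, the degree in v shifts from s to s + 1; there 1 + (1 + u)^n
   contributes nothing and only the trace remains. *)
move=> /(congr1 (fun p : T => s.+1%:R * p`_s.+1`_a)).
rewrite coefXM /= -/(unity_prod q n.+1) => ->.
have -> : (1 + u) ^+ n.+1 = ((1 + 'X) ^+ n.+1)%:P :> T.
  by rewrite rmorphXn /= polyCD polyC1.
rewrite !(coefB, coefD).
have -> : (1 : T)`_s.+1 = 0 by rewrite coef1.
have -> : ((1 + 'X) ^+ n.+1)%:P`_s.+1 = 0 :> {poly F} by rewrite coefC.
rewrite coef0 !add0r mulrN coef_tr addSnnS.
have -> : (a + 2 * s = s + a + s)%N by lia.
by rewrite exprS mulN1r mulNr opprK.
Qed.
End Genfun.

(** * Enumeration of the tuples d and their multi-indices *)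

(* All (d_0, ..., d_s) with d_0 + ... + d_s + s = l, so that l is the depth of
   the multi-index attached to d. *)
Fixpoint comps (l s : nat) : seq (seq nat) :=
  if l is l'.+1 then
    [seq (head 0 d).+1 :: behead d | d <- comps l' s]
      ++ (if s is s'.+1 then [seq 0 :: d | d <- comps l' s'] else [::])
  else if s is 0 then [:: [:: 0]] else [::].

Lemma size_comps l s : size (comps l s) = 'C(l, s).
Proof.
elim: l s => [|l IH] [|s] //=; rewrite size_cat size_map IH ?size_map ?IH //.
by rewrite !bin0.
Qed.

Lemma mem_comps l s d :
  (d \in comps l s) = (size d == s.+1) && (sumn d + s == l)%N.
Proof.
elim: l s d => [|l IH] s d.
  case: s => [|s] /=; last by rewrite in_nil; lia.
  by case: d => [|[|x] [|y d]].
rewrite /= mem_cat; case: d => [|[|x] d].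
- rewrite /=; apply/negbTE/norP; split; first by apply/mapP => -[].
  by case: s => [|s] //; apply/mapP => -[].
- have -> : (0%N :: d \in [seq (head 0 d0).+1 :: behead d0 | d0 <- comps l s]) = false.
    by apply/mapP => -[].
  case: s => [|s] /=; first by case: d => //=; lia.
  by rewrite mem_map ?IH => [|? ? []//]; rewrite add0n addnS !eqSS.
have -> : (x.+1 :: d \in (if s is s'.+1 then [seq 0 :: d0 | d0 <- comps l s'] else [::])) = false.
  by case: s => [//|s]; apply/mapP => -[].
rewrite orbF; apply/mapP/idP => [[d' + [-> ->]]|].
  rewrite IH; case: d' => //= y d'; lia.
by move=> H; exists (x :: d) => //; rewrite IH; move: H => /=; lia.
Qed.

Lemma uniq_comps l s : uniq (comps l s).
Proof.
elim: l s => [|l IH] s; first by case: s.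
(* Injectivity holds only on nonempty sequences: [[::]] and [[:: 0]] have the same image. *)
have injS : {in comps l s &, injective (fun d => (head 0 d).+1 :: behead d)}.
  move=> [|x d] [|y d']; rewrite ?mem_comps //= => _ _ [-> ->] //.
rewrite /= cat_uniq map_inj_in_uniq ?IH //=; apply/andP; split.
  apply/hasPn => d; case: s {injS} => // s /mapP[d' _ ->].
  by apply/mapP => -[].
by case: s {injS} => // s; rewrite map_inj_uniq // => ? ? [].
Qed.

(** Rotation preserves length and sum, hence permutes [comps l s]. This makes all terms of a cyclic
    sum equal on average. *)
Lemma sum_comps_rot (V : nmodType) (G : seq nat -> V) l s j :
  \sum_(d <- comps l s) G (rot j d) = \sum_(d <- comps l s) G d.
Proof.
rewrite -(big_map (rot j) xpredT G); apply: perm_big.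
apply: uniq_perm; rewrite ?map_inj_uniq ?uniq_comps //; first exact: rot_inj.
move=> d; rewrite -[d](rotrK j) mem_map; last exact: rot_inj.
have sumn_rot e : sumn (rot j e) = sumn e by apply: perm_sumn; rewrite perm_rot.
by rewrite !mem_comps size_rot sumn_rot.
Qed.

Definition word (d : seq nat) : seq nat :=
  nseq (head 0%N d) 1%N ++ flatten [seq 2%N :: nseq x 1%N | x <- behead d].

(** Reading indices modulo s + 1 from position j on amounts to rotating the list by j. *)
Lemma cyc_index_word s (d : seq nat) (j : 'I_s.+1) : size d = s.+1 ->
  cyc_index 1 (fun i : 'I_s.+1 => nth 0%N d i) j = word (rot j d).
Proof.
move=> sz.
have nth_rot_mod i : (i < s.+1)%N ->
    nth 0%N (rot j d) i = nth 0%N d ((j + i) %% s.+1).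
  move=> lt_i; have lt_j := ltn_ord j.
  rewrite /rot nth_cat size_drop sz nth_drop ltn_subRL.
  case: ltnP => le; first by rewrite modn_small.
  rewrite nth_take; last by lia.
  have -> : (j + i = (i - (s.+1 - j)) + s.+1)%N by lia.
  by rewrite modnDr modn_small; lia.
have size_r : size (rot j d) = s.+1 by rewrite size_rot.
rewrite /cyc_index /word -nth0 nth_rot_mod // addn0 modn_small //.
congr (_ ++ flatten _).
have -> : behead (rot j d) = [seq nth 0%N (rot j d) i | i <- iota 1 s].
  apply: (@eq_from_nth _ 0%N); rewrite size_behead size_r ?size_map ?size_iota //.
  move=> i lt_i; rewrite nth_behead (nth_map 0%N) ?size_iota // nth_iota //.
rewrite -map_comp; apply/eq_in_map => i; rewrite mem_iota => lt_i /=.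
by rewrite nth_rot_mod //; lia.
Qed.

Lemma sum_tuple_cons (V : nmodType) (I : finType) l
    (P : pred (l.+1.-tuple I)) (G : l.+1.-tuple I -> V) :
  \sum_(m | P m) G m
  = \sum_i \sum_(m : l.-tuple I | P [tuple of i :: m]) G [tuple of i :: m].
Proof.
rewrite pair_big_dep /=.
rewrite (reindex (fun p : I * l.-tuple I => [tuple of p.1 :: p.2])) //=.
exists (fun m : l.+1.-tuple I => (thead m, [tuple of behead m])) => [[i m] _ | m _].
  by congr (_, _); apply: val_inj.
by rewrite /= -tuple_eta.
Qed.

(** * Recursive form of the q-series and its comparison with the product *)

Section Zq.
Variables (F : fieldType) (q : F).

Definition zterm k m : F := q ^+ (k.-1 * m) / qint q m ^+ k.

Fixpoint zrec (ks : seq nat) (n : nat) : F :=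
  if ks is k :: ks' then \sum_(1 <= m < n) zterm k m * zrec ks' m else 1.

(* The extra bound b on the first index makes the induction on ks go through;
   the indices themselves stay in 'I_n. *)
Lemma zrecE ks n b : (b <= n)%N ->
  \sum_(m : (size ks).-tuple 'I_n |
       [&& all (fun a : 'I_n => (a < b)%N) m,
          sorted (fun a b : 'I_n => (b < a)%N) m &
          all (fun a : 'I_n => (0 < a)%N) m])
    q ^+ (\sum_(j < size ks) (nth 0 ks j).-1 * tnth m j)%N
      / \prod_(j < size ks) qint q (tnth m j) ^+ nth 0%N ks j
  = zrec ks b.
Proof.
elim: ks b => [|k ks IH] b le_bn /=.
  rewrite (big_pred1 [tuple]) => [|m]; last by rewrite tuple0.
  by rewrite !big_ord0 expr0 divr1.
rewrite sum_tuple_cons /=.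
have -> : \sum_(1 <= m < b) zterm k m * zrec ks m
  = \sum_(i < n | (0 < i < b)%N) zterm k i * zrec ks i.
  rewrite (big_nat_widen _ _ _ _ _ le_bn) big_geq_mkord.
  by apply: eq_bigl => i; rewrite andbC.
rewrite [RHS]big_mkcond; apply: eq_bigr => i _.
case: ifP => [/andP[i_gt0 lt_ib] | i_out]; last first.
  rewrite big_pred0 // => m; apply/negbTE; move: i_out => /negbT; apply: contra.
  by case/and3P => /andP[-> _] _ /andP[-> _].
rewrite -IH; last by apply: ltnW.
rewrite big_distrr /=; apply: eq_big => [m|m _].
  rewrite lt_ib i_gt0 /= path_sortedE; last by move=> x y z lt_xy lt_zx; exact: ltn_trans lt_zx lt_xy.
  set A := all _ m; set B := all _ m; set C := sorted _ m; set D := all _ m.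
  (* The tail lies below the first index i, and i < b, so its bound by b is automatic. *)
  suff : B -> A by case: A B C D => [] [] [] [] // /(_ isT).
  by apply: sub_all => x lt_xi; apply: ltn_trans lt_xi lt_ib.
rewrite !big_ord_recl /= tnth0 exprD invfM mulrACA.
by congr (_ * (q ^+ _ / _)); apply: eq_bigr => j _; rewrite tnthS.
Qed.

Lemma zq_zrec n ks : zq n ks q = zrec ks n.
Proof.
rewrite -(zrecE ks (leqnn n)); apply: eq_bigl => m.
by have -> : all (fun a : 'I_n => (a < n)%N) m by apply/allP.
Qed.

Lemma zrecS k ks n : (0 < n)%N ->
  zrec (k :: ks) n.+1 = zrec (k :: ks) n + zterm k n * zrec ks n.
Proof. by move=> n_gt0; rewrite /= big_nat_recr. Qed.

(** The coefficient of u^(l - s) v^s in prod_(0 < m < n) (1 + u/[m] + v q^m/[m]^2) when s <= l, and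
    0 otherwise. *)
Definition zsum n l s := \sum_(d <- comps l s) zrec (word d) n.

(** Either m_1 < n, or m_1 = n carries the entry 1 or 2; these two entries correspond to the two
    branches of [comps]. *)
Lemma zsumS n l s : (0 < n)%N ->
  zsum n.+1 l.+1 s = zsum n l.+1 s + zterm 1 n * zsum n l s
    + (if s is s'.+1 then zterm 2 n * zsum n l s' else 0).
Proof.
move=> n_gt0; rewrite /zsum /= !big_cat !big_map /=.
have -> : \sum_(d <- comps l s) zrec (word ((head 0%N d).+1 :: behead d)) n.+1
  = \sum_(d <- comps l s) zrec (word ((head 0%N d).+1 :: behead d)) n
    + zterm 1 n * \sum_(d <- comps l s) zrec (word d) n.
  rewrite mulr_sumr -big_split; apply: eq_bigr => d _; exact: zrecS.
case: s => [|s]; first by rewrite !big_nil !addr0.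
rewrite !big_map.
have -> : \sum_(d <- comps l s) zrec (word (0%N :: d)) n.+1
  = \sum_(d <- comps l s) zrec (word (0%N :: d)) n
    + zterm 2 n * \sum_(d <- comps l s) zrec (word d) n.
  (* Membership makes d nonempty; only then does a leading 0 put the entry 2 in front of
     [word d]. *)
  rewrite mulr_sumr -big_split; apply: eq_big_seq => -[|x d]; rewrite mem_comps //.
  by move=> _; exact: zrecS.
by ring.
Qed.

Lemma zsum1 l s : zsum 1 l s = ((l == 0%N) && (s == 0%N))%:R.
Proof.
rewrite /zsum; case: l => [|l].
  by case: s => [|s] /=; rewrite ?big_nil ?big_seq1.
rewrite /= big_cat /= big_map big1 => [|d _]; last by rewrite /= big_geq.
case: s => [|s]; rewrite ?big_nil add0r // big_map big_seq big1 // => -[|x d].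
  by rewrite mem_comps.
by rewrite /= big_geq.
Qed.

(** Multiplying 1 + u/[m] + v q^m/[m]^2 by (1 - q^m)^2 gives the factor of [unity_prod] at (1 - q) u
    and (1 - q)^2 v, whence the power a + 2 s of 1 - q. The induction on n matches the two
    recurrences. *)
Lemma zsum_unity_prod n a s :
  (forall m, (0 < m < n.+1)%N -> q ^+ m != 1) ->
  zsum n.+1 (a + s) s * \prod_(1 <= m < n.+1) (1 - q ^+ m) ^+ 2
  = (1 - q) ^+ (a + 2 * s) * (unity_prod q n.+1)`_s`_a.
Proof.
elim: n a s => [|n IH] a s q_neq1.
  rewrite zsum1 /unity_prod !big_geq // mulr1 coef1 addn_eq0.
  case: s => [|s]; rewrite ?coef0 ?andbF ?mulr0 // coef1 andbT addn0.
  by case: a => [|a]; rewrite ?mulr1 ?mulr0.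
have qn : 1 - q ^+ n.+1 != 0 by rewrite subr_eq0 eq_sym q_neq1 ?ltnSn.
have q1 : 1 - q != 0.
  by apply: contra_neq qn => /eqP; rewrite subr_eq0 => /eqP <-; rewrite expr1n subrr.
have {}IH a' s' := IH a' s' (fun m H => q_neq1 m ltac:(lia)).
rewrite coef_unity_prodS // big_nat_recr //=.
set P := \prod_(_ <= _ < _) _ in IH *.
have t1 : zterm 1 n.+1 * (1 - q ^+ n.+1) = 1 - q.
  by rewrite /zterm /qint /= mul0n; field; rewrite qn q1.
have t2 : zterm 2 n.+1 * (1 - q ^+ n.+1) ^+ 2 = (1 - q) ^+ 2 * q ^+ n.+1.
  by rewrite /zterm /qint /= mul1n; field; rewrite qn q1.
set r := 1 - q ^+ n.+1 in t1 t2 *; set h := 1 - q in IH t1 t2 *.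
have step A B C : (A + zterm 1 n.+1 * B + zterm 2 n.+1 * C) * (P * r ^+ 2)
    = (A * P) * r ^+ 2 + h * r * (B * P) + h ^+ 2 * q ^+ n.+1 * (C * P).
  by rewrite -t2 -t1; ring.
case: a s => [|a] [|s].
- by have := IH 0%N 0%N; rewrite /zsum /= !big_seq1 /= !mul1r => ->; ring.
(* For a = 0 no multi-index begins with 1: [comps s s.+1] is empty. *)
- have -> : zsum n.+2 (0 + s.+1) s.+1
      = zsum n.+1 (0 + s.+1) s.+1 + zterm 1 n.+1 * 0 + zterm 2 n.+1 * zsum n.+1 s s.
    rewrite {1}add0n zsumS //; congr (_ + _ * _ + _).
    by rewrite /zsum (size0nil (s := comps s s.+1)) ?big_nil // size_comps bin_small.
  rewrite step IH -[zsum n.+1 s s]/(zsum n.+1 (0 + s) s) IH.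
  have -> : (0 + 2 * s.+1 = (0 + 2 * s).+2)%N by lia.
  by rewrite !exprS; ring.
- have -> : zsum n.+2 (a.+1 + 0) 0 = zsum n.+1 (a.+1 + 0) 0
      + zterm 1 n.+1 * zsum n.+1 (a + 0) 0 + zterm 2 n.+1 * 0.
    by rewrite addSn zsumS // mulr0.
  by rewrite step !IH addSn exprS; ring.
have -> : zsum n.+2 (a.+1 + s.+1) s.+1 = zsum n.+1 (a.+1 + s.+1) s.+1
    + zterm 1 n.+1 * zsum n.+1 (a + s.+1) s.+1 + zterm 2 n.+1 * zsum n.+1 (a.+1 + s) s.
  by rewrite addSn zsumS // addSnnS.
rewrite step !IH.
have -> : (a.+1 + 2 * s.+1 = (a + 2 * s).+3)%N by lia.
have -> : (a + 2 * s.+1 = (a + 2 * s).+2)%N by lia.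
by rewrite addSn !exprS; ring.
Qed.
End Zq.

(** * Specialisation to a primitive root of unity and averaging *)

Section Average.
Variables (F : numFieldType) (q : F) (n : nat).
Hypotheses (n_gt0 : (0 < n)%N) (q_prim : n.-primitive_root q).

Lemma prim_root_neq1 m : (0 < m < n)%N -> q ^+ m != 1.
Proof.
by case/andP=> m_gt0 lt_mn; rewrite -(prim_order_dvd q_prim) gtnNdvd.
Qed.

(** The factor 1/n is the n from [coef_unity_prod] divided by the normalising product, which equals
    n^2. *)
Lemma zsum_prim_root a s :
  s.+1%:R * zsum q n (a + s) s
  = (1 - q) ^+ (a + 2 * s) * (-1) ^+ s / n%:R
      * ('C(a + s, s) * 'C(n + s, (a + 2 * s).+1))%:R.
Proof.
have zE a' s' : zsum q n (a' + s') s' * \prod_(1 <= m < n) (1 - q ^+ m) ^+ 2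
    = (1 - q) ^+ (a' + 2 * s') * (unity_prod q n)`_s'`_a'.
  move: n_gt0 prim_root_neq1; case: n => // n' _ neq1.
  exact: zsum_unity_prod.
have n0 : n%:R != 0 :> F by rewrite pnatr_eq0 -lt0n.
(* The term a = s = 0 evaluates the normalising product. *)
have P2 : \prod_(1 <= m < n) (1 - q ^+ m) ^+ 2 = n%:R ^+ 2.
  have := zE 0%N 0%N; rewrite /zsum /= big_seq1 /= !mul1r => ->.
  have := coef_unity_prod 0 0 n_gt0 q_prim.
  by rewrite !addn0 bin0 bin1 !mul1n natrM !mul1r.
apply: (mulIf (expf_neq0 2 n0)); rewrite -{1}P2 -[LHS]mulrA zE mulrCA.
rewrite coef_unity_prod // natrM; field.
by [].
Qed.

(** After exchanging the sums, each of the s + 1 rotations yields the same total. *)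
Lemma sum_cyc_sum a s :
  \sum_(d <- comps (a + s) s) cyc_sum n 1 (fun i : 'I_s.+1 => nth 0%N d i) q
  = s.+1%:R * zsum q n (a + s) s.
Proof.
transitivity (\sum_(d <- comps (a + s) s) \sum_(j < s.+1) zrec q (word (rot j d)) n).
  apply: eq_big_seq => d; rewrite mem_comps => /andP[/eqP sz _].
  by apply: eq_bigr => j _; rewrite cyc_index_word // zq_zrec.
rewrite exchange_big /=.
rewrite (eq_bigr (fun=> zsum q n (a + s) s)) => [|j _].
  by rewrite sumr_const card_ord mulr_natl.
exact: (sum_comps_rot (fun d => zrec q (word d) n)).
Qed.
End Average.

Theorem corollary1p4 (R : realType) (n k s : nat) (zeta : R[i])
    (hn : (0 < n)%N) (hkn : (k < n)%N) (hzeta : n.-primitive_root zeta) :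
  (forall d : 'I_s.+1 -> nat,
      (\sum_(j < s.+1) d j)%N%:Z = k%:Z - (2 * s)%N%:Z ->
      cyc_sum n 1 d zeta
      = (-1) ^+ s / n%:R * 'C(n + s, k.+1)%:R * (1 - zeta) ^+ k)
  <->
  (forall d d' : 'I_s.+1 -> nat,
      (\sum_(j < s.+1) d j)%N%:Z = k%:Z - (2 * s)%N%:Z ->
      (\sum_(j < s.+1) d' j)%N%:Z = k%:Z - (2 * s)%N%:Z ->
      cyc_sum n 1 d zeta = cyc_sum n 1 d' zeta).
Proof.
split=> [H d d' hd hd' | H d hd]; first by rewrite !H.
set a := (\sum_(j < s.+1) d j)%N in hd.
(* The hypothesis is an equation in the integers, so the existence of d forces 2 s <= k. *)
have kE : k = (a + 2 * s)%N by lia.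
(* By (ii) every summand equals the one for d, and [comps (a + s) s] has 'C(a + s, s) members. *)
have cst_sum : \sum_(d' <- comps (a + s) s)
      cyc_sum n 1 (fun i : 'I_s.+1 => nth 0%N d' i) zeta
    = 'C(a + s, s)%:R * cyc_sum n 1 d zeta.
  rewrite mulr_natl -size_comps -count_predT -iter_addr_0 -big_const_seq.
  apply: eq_big_seq => d'; rewrite mem_comps => /andP[/eqP sz /eqP sum_d'].
  apply: H => //; rewrite -(big_mkord xpredT (nth 0%N d')) -sz.
  by rewrite -(big_nth 0%N xpredT id) -sumnE; lia.
move: cst_sum; rewrite sum_cyc_sum zsum_prim_root // -kE natrM => E.
(* The number of tuples also divides the closed form of the total; being nonzero in characteristic
   0, it cancels. *)
have C0 : 'C(a + s, s)%:R != 0 :> R[i].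
  by rewrite pnatr_eq0 -lt0n bin_gt0 leq_addl.
apply: (mulfI C0); rewrite -E; ring.
Qed.
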